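(* Let $l,l'\ge 1$ be natural numbers, let $r_1,\dots,r_l\in\mathbb{C}$ and let $s_1,\dots,s_{l'}\in\mathbb{C}\setminus\{0\}$. Let $\mathbb{B}=\mathbb{B}(r_1,\dots,r_l;s_1,\dots,s_{l'})$, acting as a bounded linear operator on $c_0$. Then $$\sigma(\mathbb{B},c_0)=\left\{\lambda\in\mathbb{C}: (|\lambda-r_1|\cdots|\lambda-r_l|)^{1/l}\le (|s_1|\cdots|s_{l'}|)^{1/l'}\right\}.$$
   Context: $c_0$ is the Banach space of complex sequences $x=(x_k)_{k\ge 0}$ converging to $0$, with the supremum norm. For an integer $a$ and $n\in\mathbb{N}$, $a\,(\mathrm{mod}\ n)$ denotes the remainder in $\{0,\dots,n-1\}$ of $a$ modulo $n$. The matrix $\mathbb{B}(r_1,\dots,r_l;s_1,\dots,s_{l'})=(b_{ij})_{i,j\ge 0}$ is the infinite lower triangular matrix with $b_{ij}=r_{j(\mathrm{mod}\ l)+1}$ if $i=j$, $b_{ij}=s_{j(\mathrm{mod}\ l')+1}$ if $i=j+1$, and $b_{ij}=0$ otherwise; it acts on $x=(x_k)_{k\ge0}$ by $(\mathbb{B}x)_k=s_{(k-1)(\mathrm{mod}\ l')+1}x_{k-1}+r_{k(\mathrm{mod}\ l)+1}x_k$, with $x_{-1}=0$. $\sigma(T,X)$ is the spectrum of the operator $T$ on $X$: the set of $\lambda\in\mathbb{C}$ for which it is not the case that $T-\lambda I$ is injective with inverse (defined on its range) bounded and with dense range. *)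

(* Defs.v *)
From HB Require Import structures.
From mathcomp Require Import all_boot all_order all_algebra.
From mathcomp Require Import all_classical all_reals all_analysis.
From mathcomp Require Import complex.

Set Implicit Arguments.
Unset Strict Implicit.
Unset Printing Implicit Defensive.

Import Order.TTheory GRing.Theory Num.Theory.
Import numFieldNormedType.Exports ComplexField.Normc.

Local Open Scope classical_set_scope.
Local Open Scope ring_scope.
Local Open Scope complex_scope.

Definition shifted (K : numFieldType) (V : normedModType K)
    (T : {linear V -> V}) (lam : K) : V -> V :=
  fun x => T x - lam *: x.

(* The inverse of [shifted T lam] is only meaningful on the range, so S is any
   total left inverse and only its values on the range are constrained. *)
Definition resolvent_set (K : numFieldType) (V : normedModType K)
    (T : {linear V -> V}) : set K :=
  [set lam | [/\ injective (shifted T lam),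
    exists2 S : V -> V, cancel (shifted T lam) S &
      exists M : K, forall y, range (shifted T lam) y -> `|S y| <= M * `|y|
    & dense (range (shifted T lam))]].

Definition spectrum (K : numFieldType) (V : normedModType K)
    (T : {linear V -> V}) : set K :=
  ~` resolvent_set T.

(* R[i]^o is R[i] seen as a normed module over itself; its topology is that of
   the modulus. *)
Definition c0_pred (R : realType) : {pred nat -> R[i]^o} :=
  fun x => `[< x @ \oo --> (0 : R[i]^o) >].

Record c0 (R : realType) := C0 {
  c0_seq :> nat -> R[i]^o;
  c0_seqP : c0_seq \in @c0_pred R }.

HB.instance Definition _ (R : realType) := [isSub for @c0_seq R].
HB.instance Definition _ (R : realType) := [Choice of c0 R by <:].

Lemma normr_normc (R : realType) (z : R[i]) : `|z| = (normc z)%:C.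
Proof. by case: z => a b; rewrite normc_def. Qed.

Lemma normc_ge0 (R : realType) (z : R[i]) : 0 <= normc z.
Proof. by rewrite -lecR -normr_normc normr_ge0. Qed.

Lemma c0_predP (R : realType) (x : nat -> R[i]^o) :
  x \in @c0_pred R <->
  forall e : R, 0 < e ->
    exists N, forall k, (N <= k)%N -> normc (x k) < e.
Proof.
split => [/asboolP xc e e0|xP].
  have e0c : 0 < e%:C by rewrite ltcR.
  have /cvgrPdist_lt/(_ _ e0c)[N _ Nx] := xc.
  exists N => k Nk; have := Nx k Nk.
  by rewrite sub0r normrN [`|_|]normr_normc ltcR.
apply/asboolP/cvgrPdist_lt => e e0.
have [e' e'E] : exists e', e = e'%:C.
  by exists (complex.Re e); rewrite RRe_real// gtr0_real.
have e'0 : 0 < e' by move: e0; rewrite e'E ltcR.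
have [N Nx] := xP _ e'0; exists N => // k Nk.
by rewrite /= sub0r normrN e'E [`|_|]normr_normc ltcR Nx.
Qed.

Lemma c0_submod_closed (R : realType) : submod_closed (@c0_pred R).
Proof.
split; first by apply/asboolP; exact: (@cvg_cst R[i]^o).
move=> a x y /c0_predP xP /c0_predP yP; apply/c0_predP => e e0.
have a0 : 0 < normc a + 1 by rewrite ltr_wpDl// normc_ge0.
have e2 : 0 < e / 2 by rewrite divr_gt0.
have [N Nx] := xP _ (divr_gt0 e2 a0); have [N' Ny] := yP _ e2.
exists (maxn N N') => k; rewrite geq_max => /andP[/Nx xk /Ny yk].
rewrite (le_lt_trans (le_normcD _ _))// (splitr e) ler_ltD//.
rewrite -[leLHS]/(normc (a * x k)) normcM.
rewrite (le_trans (ler_wpM2l (normc_ge0 _) (ltW xk)))//.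
rewrite mulrC mulrAC -mulrA ler_piMr ?(ltW e2)//.
by rewrite ler_pdivrMr// mul1r lerDl.
Qed.

HB.instance Definition _ (R : realType) :=
  GRing.isSubmodClosed.Build R[i] (nat -> R[i]^o) (@c0_pred R)
    (@c0_submod_closed R).
HB.instance Definition _ (R : realType) :=
  [SubChoice_isSubLmodule of c0 R by <:].

Definition c0_norm (R : realType) (x : c0 R) : R :=
  sup (range (fun k => normc (x k))).

Lemma c0_bounded (R : realType) (x : c0 R) :
  has_ubound (range (fun k => normc (x k))).
Proof.
have [N xN] := (c0_predP x).1 (c0_seqP x) 1 ltr01.
exists (1 + \sum_(i < N) normc (x i)) => _ [k _ <-].
have [Nk|kN] := leqP N k.
  by rewrite (le_trans (ltW (xN k Nk)))// lerDl sumr_ge0// => i _; exact: normc_ge0.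
rewrite (bigD1 (Ordinal kN))//= addrCA lerDl addr_ge0// sumr_ge0// => i _.
exact: normc_ge0.
Qed.

Lemma le_c0_norm (R : realType) (x : c0 R) k : normc (x k) <= c0_norm x.
Proof. by apply: ub_le_sup; [exact: c0_bounded | exists k]. Qed.

Lemma c0_norm_le (R : realType) (x : c0 R) (M : R) :
  (forall k, normc (x k) <= M) -> c0_norm x <= M.
Proof.
move=> xM; apply: ge_sup => [|_ [k _ <-]//]; by exists (normc (x 0%N)), 0%N.
Qed.

Lemma c0_seqD (R : realType) (x y : c0 R) k : (x + y : c0 R) k = x k + y k.
Proof. by []. Qed.

Lemma c0_seqZ (R : realType) (a : R[i]) (x : c0 R) k :
  (a *: x : c0 R) k = a * x k.
Proof. by []. Qed.

Lemma ler_c0_normD (R : realType) (x y : c0 R) :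
  (c0_norm (x + y))%:C <= (c0_norm x)%:C + (c0_norm y)%:C.
Proof.
rewrite -rmorphD lecR; apply: c0_norm_le => k; rewrite c0_seqD.
by rewrite (le_trans (le_normcD _ _))// lerD ?le_c0_norm.
Qed.

Lemma c0_normZ (R : realType) (a : R[i]) (x : c0 R) :
  (c0_norm (a *: x))%:C = `|a| * (c0_norm x)%:C.
Proof.
rewrite normr_normc -rmorphM; congr _%:C; apply/eqP; rewrite eq_le.
apply/andP; split.
  apply: c0_norm_le => k; rewrite c0_seqZ normcM.
  by rewrite ler_wpM2l ?normc_ge0 ?le_c0_norm.
have [->|a0] := eqVneq a 0.
  by rewrite normc0 mul0r (le_trans (normc_ge0 _) (le_c0_norm _ 0)).
have na0 : 0 < normc a.
  by rewrite lt_def normc_ge0 andbT; apply: contraNneq a0 => /eq0_normc ->.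
rewrite mulrC -ler_pdivlMr//; apply: c0_norm_le => k.
by rewrite ler_pdivlMr// mulrC -normcM -c0_seqZ le_c0_norm.
Qed.

Lemma c0_norm_eq0 (R : realType) (x : c0 R) : (c0_norm x)%:C = 0 -> x = 0.
Proof.
move=> -[x0]; apply: val_inj; apply/funext => k /=; apply: eq0_normc.
by apply/eqP; rewrite eq_le normc_ge0 andbT -x0 le_c0_norm.
Qed.

(* A normed module over R[i] has an R[i]-valued norm, whence the embedding of
   the supremum into R[i]. *)
HB.instance Definition _ (R : realType) :=
  Lmodule_isNormed.Build R[i] (c0 R)
    (@ler_c0_normD R) (@c0_normZ R) (@c0_norm_eq0 R).

(* Entries of the infinite matrix; the proofs that l and l' are positive make
   the reductions modulo l and l' legal indices. *)
Definition bidiag (R : realType) (l l' : nat) (hl : (0 < l)%N)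
    (hl' : (0 < l')%N) (r : 'I_l -> R[i]) (s : 'I_l' -> R[i])
    (i j : nat) : R[i] :=
  if i == j then r (Ordinal (ltn_pmod j hl))
  else if i == j.+1 then s (Ordinal (ltn_pmod j hl'))
  else 0.

(* Action of a lower triangular infinite matrix: entries j > k vanish. *)
Definition ltri_act (R : realType) (b : nat -> nat -> R[i])
    (x : nat -> R[i]^o) : nat -> R[i]^o :=
  fun k => \sum_(j < k.+1) b k j * x j.

Lemma bidiag_act0 (R : realType) (l l' : nat) (hl : (0 < l)%N)
    (hl' : (0 < l')%N) (r : 'I_l -> R[i]) (s : 'I_l' -> R[i])
    (x : nat -> R[i]^o) :
  ltri_act (bidiag hl hl' r s) x 0 = r (Ordinal (ltn_pmod 0 hl)) * x 0%N.
Proof. by rewrite /ltri_act big_ord1. Qed.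

Lemma bidiag_actS (R : realType) (l l' : nat) (hl : (0 < l)%N)
    (hl' : (0 < l')%N) (r : 'I_l -> R[i]) (s : 'I_l' -> R[i])
    (x : nat -> R[i]^o) k :
  ltri_act (bidiag hl hl' r s) x k.+1 =
  s (Ordinal (ltn_pmod k hl')) * x k + r (Ordinal (ltn_pmod k.+1 hl)) * x k.+1.
Proof.
rewrite /ltri_act !big_ord_recr /= big1 => [|j _]; last first.
  have jk := ltn_ord j.
  by rewrite /bidiag eqSS (gtn_eqF jk) (gtn_eqF (leqW jk)) mul0r.
by rewrite add0r /bidiag eqxx gtn_eqF// eqxx.
Qed.

Definition bidiag_bound (R : realType) (l l' : nat)
    (r : 'I_l -> R[i]) (s : 'I_l' -> R[i]) : R :=
  \sum_(i < l') normc (s i) + \sum_(i < l) normc (r i).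

Lemma le_sum_normc (R : realType) (n : nat) (f : 'I_n -> R[i]) i :
  normc (f i) <= \sum_(j < n) normc (f j).
Proof.
by rewrite (bigD1 i)//= lerDl sumr_ge0// => j _; exact: normc_ge0.
Qed.

Lemma bidiag_act_le (R : realType) (l l' : nat) (hl : (0 < l)%N)
    (hl' : (0 < l')%N) (r : 'I_l -> R[i]) (s : 'I_l' -> R[i])
    (x : nat -> R[i]^o) (M : R) k :
  (forall j, (k.-1 <= j)%N -> normc (x j) <= M) ->
  normc (ltri_act (bidiag hl hl' r s) x k) <= bidiag_bound r s * M.
Proof.
move=> xM; have M0 : 0 <= M := le_trans (normc_ge0 _) (xM k (leq_pred k)).
have rM j i : (k.-1 <= j)%N -> normc (r i * x j) <= (\sum_(i < l) normc (r i)) * M.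
  by move=> kj; rewrite normcM ler_pM ?normc_ge0 ?le_sum_normc ?xM.
have sM j i : (k.-1 <= j)%N -> normc (s i * x j) <= (\sum_(i < l') normc (s i)) * M.
  by move=> kj; rewrite normcM ler_pM ?normc_ge0 ?le_sum_normc ?xM.
rewrite mulrDl; case: k => [|k] in xM rM sM *.
  rewrite bidiag_act0 (le_trans (rM _ _ _))// lerDr mulr_ge0// sumr_ge0// => i _.
  exact: normc_ge0.
by rewrite bidiag_actS (le_trans (le_normcD _ _))// lerD ?rM ?sM//=.
Qed.

Lemma bidiag_c0 (R : realType) (l l' : nat) (hl : (0 < l)%N)
    (hl' : (0 < l')%N) (r : 'I_l -> R[i]) (s : 'I_l' -> R[i]) (x : c0 R) :
  ltri_act (bidiag hl hl' r s) x \in @c0_pred R.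
Proof.
have B0 : 0 <= bidiag_bound r s.
  by rewrite addr_ge0// sumr_ge0// => i _; exact: normc_ge0.
apply/c0_predP => e e0.
have B1 : 0 < bidiag_bound r s + 1 by rewrite ltr_wpDl.
have [N xN] := (c0_predP x).1 (c0_seqP x) _ (divr_gt0 e0 B1).
exists N.+1 => k Nk.
have xk j : (k.-1 <= j)%N -> normc (x j) <= e / (bidiag_bound r s + 1).
  by move=> kj; apply/ltW/xN; apply: leq_trans kj; rewrite -ltnS (ltn_predK Nk).
rewrite (le_lt_trans (bidiag_act_le hl hl' r s xk))//.
by rewrite mulrCA gtr_pMr// ltr_pdivrMr// mul1r ltrDl.
Qed.

Definition bidiag_op (R : realType) (l l' : nat) (hl : (0 < l)%N)
    (hl' : (0 < l')%N) (r : 'I_l -> R[i]) (s : 'I_l' -> R[i]) (x : c0 R) : c0 R :=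
  C0 (bidiag_c0 hl hl' r s x).

Lemma bidiag_op_is_linear (R : realType) (l l' : nat) (hl : (0 < l)%N)
    (hl' : (0 < l')%N) (r : 'I_l -> R[i]) (s : 'I_l' -> R[i]) :
  linear (bidiag_op hl hl' r s).
Proof.
move=> a x y; apply: val_inj; apply/funext => k /=.
rewrite -[RHS]/(a * ltri_act (bidiag hl hl' r s) x k
                + ltri_act (bidiag hl hl' r s) y k).
rewrite /ltri_act mulr_sumr -big_split /=; apply: eq_bigr => j _.
by rewrite [X in _ * X = _](_ : _ = a * x j + y j)// mulrDr mulrCA.
Qed.

HB.instance Definition _ (R : realType) (l l' : nat) (hl : (0 < l)%N)
    (hl' : (0 < l')%N) (r : 'I_l -> R[i]) (s : 'I_l' -> R[i]) :=
  GRing.isLinear.Build R[i] (c0 R) (c0 R) _ (bidiag_op hl hl' r s)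
    (bidiag_op_is_linear hl hl' r s).

Lemma bidiag_op_bounded (R : realType) (l l' : nat) (hl : (0 < l)%N)
    (hl' : (0 < l')%N) (r : 'I_l -> R[i]) (s : 'I_l' -> R[i]) (x : c0 R) :
  `|bidiag_op hl hl' r s x| <= (bidiag_bound r s)%:C * `|x|.
Proof.
rewrite -[`|x|]/(c0_norm x)%:C -[leLHS]/(c0_norm _)%:C -rmorphM lecR.
apply: c0_norm_le => k; apply: bidiag_act_le => j _; exact: le_c0_norm.
Qed.

(* Main.v *)
Require Import Defs.
From HB Require Import structures.
From mathcomp Require Import all_boot all_order all_algebra.
From mathcomp Require Import all_classical all_reals all_analysis.
From mathcomp Require Import complex.
From mathcomp Require Import ring lra.

Set Implicit Arguments.
Unset Strict Implicit.
Unset Printing Implicit Defensive.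

Import Order.TTheory GRing.Theory Num.Theory.
Import numFieldNormedType.Exports ComplexField.Normc.

Local Open Scope classical_set_scope.
Local Open Scope ring_scope.

(* Write a_k = r_k - lam, b_k = s_k (periodically extended), and let alpha, beta
   be the geometric means of |a| and |b| over a period.  Periodicity makes
   prod_(j < k) |a_j| comparable to alpha ^ k, and likewise for b and beta.
   If beta < alpha, put rho = beta / alpha < 1: the equation (B - lam) x = y is a
   first-order recursion which, in suitable bounded weights, contracts by the
   constant factor rho, so that B - lam is bijective with bounded inverse.
   If alpha <= beta, the sequence f_k = prod_(j < k) (- a_j / b_j) is bounded and
   formally annihilates the range: sum_(k <= n) f_k ((B - lam) x)_k equals
   f_n a_n x_n.  A bounded inverse and a dense range would force f to be summable
   (test on x with (B - lam) x close to the phases of f), and then f would be a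
   continuous functional vanishing on the range, although f_0 = 1. *)

(** * Growth of periodic products and of affine recursions *)

(** A shift by one period multiplies the partial product by the full product, which is at most
    [g ^+ l]. So the quotient by [g ^+ k] is bounded by its values over the first period. *)
Lemma prod_periodic_le (R : realFieldType) (l : nat) (hl : (0 < l)%N)
    (c : 'I_l -> R) (g : R) :
  0 < g -> (forall i, 0 <= c i) -> \prod_i c i <= g ^+ l ->
  exists2 C, 0 < C &
    forall k, \prod_(j < k) c (Ordinal (ltn_pmod j hl)) <= C * g ^+ k.
Proof.
move=> g0 c0 cg; set P := fun k => \prod_(j < k) c (Ordinal (ltn_pmod j hl)).
have P0 k : 0 <= P k by apply: prodr_ge0.
have Pl : P l = \prod_i c i.
  by apply: eq_bigr => i _; congr c; apply: val_inj; rewrite /= modn_small.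
have PS k : P (l + k)%N = P l * P k.
  rewrite /P big_split_ord/=; congr (_ * _); apply: eq_bigr => i _; congr c.
  by apply: val_inj; rewrite /= modnDl.
pose Q k := P k / g ^+ k; have Q0 k : 0 <= Q k by rewrite divr_ge0// ltW// exprn_gt0.
exists (1 + \sum_(i < l) Q i); first by rewrite ltr_wpDr// sumr_ge0.
move=> k; rewrite -ler_pdivrMr ?exprn_gt0// -/(P k) -/(Q k).
elim/ltn_ind: k => k IH; have [lk|kl] := leqP l k.
  have -> : Q k = Q l * Q (k - l)%N.
    by rewrite -{1}(subnKC lk) /Q PS exprD invfM mulrACA.
  apply: le_trans (IH (k - l)%N _); last by rewrite ltn_subrL hl (leq_trans hl).
  by rewrite ler_piMl// /Q Pl ler_pdivrMr ?exprn_gt0// mul1r.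
by rewrite (bigD1 (Ordinal kl))//= addrCA lerDl addr_ge0 ?sumr_ge0.
Qed.

(** [t / (1 - rho)] is the fixed point of [v |-> rho * v + t], and the map contracts towards it by
    [rho]. *)
Lemma affine_recursion_le (R : realFieldType) (v : nat -> R) (rho t : R) N :
  0 <= rho -> rho < 1 -> 0 <= t ->
  (forall k, (N <= k)%N -> v k.+1 <= rho * v k + t) ->
  forall k, v (N + k)%N <= rho ^+ k * v N + t / (1 - rho).
Proof.
move=> r0 r1 t0 vS; have r1' : 0 < 1 - rho by rewrite subr_gt0.
elim=> [|k IH]; first by rewrite addn0 expr0 mul1r lerDl divr_ge0// ltW.
rewrite addnS (le_trans (vS _ (leq_addr _ _)))//.
have -> : rho ^+ k.+1 * v N + t / (1 - rho) =
    rho * (rho ^+ k * v N + t / (1 - rho)) + t.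
  by rewrite exprS; field; rewrite gt_eqF.
by rewrite lerD2r ler_wpM2l.
Qed.

(** * Moduli, phases and approximation in [c0] *)

Lemma normc_real (R : realType) (x : R) : normc x%:C%C = `|x|.
Proof. by rewrite /normc /= expr0n/= addr0 sqrtr_sqr. Qed.

Lemma le_normc_sum (R : realType) n (f : nat -> R[i]) :
  normc (\sum_(k < n) f k) <= \sum_(k < n) normc (f k).
Proof.
elim: n => [|n IH]; first by rewrite !big_ord0 normc0.
by rewrite !big_ord_recr/= (le_trans (le_normcD _ _))// lerD2r.
Qed.

Lemma normc_pairing_le (R : realType) n (f u y : nat -> R[i]) (e : R) :
  (forall k, normc (u k - y k) <= e) ->
  normc (\sum_(k < n) f k * u k) <=
  normc (\sum_(k < n) f k * y k) + e * \sum_(k < n) normc (f k).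
Proof.
move=> uy.
rewrite (_ : \sum_(k < n) f k * u k =
  \sum_(k < n) f k * y k + \sum_(k < n) f k * (u k - y k)); last first.
  by rewrite -big_split; apply: eq_bigr => k _ /=; ring.
rewrite (le_trans (le_normcD _ _))// lerD2l.
rewrite (le_trans (le_normc_sum _ (fun k => f k * (u k - y k))))//.
by rewrite mulr_sumr ler_sum// => k _; rewrite normcM mulrC ler_wpM2r ?normc_ge0.
Qed.

Lemma exists_phase (R : realType) (z : R[i]) :
  exists u : R[i], normc u <= 1 /\ z * u = (normc z)%:C%C.
Proof.
have [->|z0] := eqVneq z 0; first by exists 0; rewrite normc0 mulr0 ler01.
exists ((normc z)%:C%C / z); split; last by rewrite mulrCA divff// mulr1.
rewrite normcM normcV normc_real ger0_norm ?normc_ge0// divff//.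
by apply: contra_neq z0 => /eq0_normc.
Qed.

Lemma dense_c0_approx (R : realType) (A : set (c0 R)) (x : c0 R) (e : R) :
  dense A -> 0 < e -> exists2 y, A y & forall k, normc (x k - y k) <= e.
Proof.
move=> dA e0; have e0c : 0 < e%:C%C by rewrite ltcR.
have [|y [/= xy Ay]] := dA (ball x e%:C%C) _ (ball_open _ _).
  by exists x; exact: ballxx.
exists y => // k; move: xy; rewrite -ball_normE /= -[`|_|]/(c0_norm _)%:C%C ltcR.
by move=> /ltW; apply: le_trans; exact: le_c0_norm (x - y) k.
Qed.

Lemma finite_c0P (R : realType) n (u : nat -> R[i]) :
  (fun k => if (k < n)%N then u k else 0) \in @c0_pred R.
Proof.
apply/c0_predP => e e0; exists n => k nk.
by rewrite ltnNge nk normc0.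
Qed.

(** The lower bound is the upper bound applied to the inverses of [c] and [g]. *)
Lemma prod_periodic_bounds (R : realFieldType) (l : nat) (hl : (0 < l)%N)
    (c : 'I_l -> R) (g : R) :
  0 < g -> (forall i, 0 < c i) -> \prod_i c i = g ^+ l ->
  exists2 C, 0 < C & forall k,
    C^-1 <= (\prod_(j < k) c (Ordinal (ltn_pmod j hl))) / g ^+ k <= C.
Proof.
move=> g0 c0 cg; pose P k := \prod_(j < k) c (Ordinal (ltn_pmod j hl)).
have P0 k : 0 < P k by apply: prodr_gt0.
have [|C C0 PC] := prod_periodic_le hl g0 (fun i => ltW (c0 i)).
  by rewrite cg.
have [|||C' C'0 PC'] := @prod_periodic_le _ l hl (fun i => (c i)^-1) g^-1.
- by rewrite invr_gt0.
- by move=> i; rewrite invr_ge0 ltW.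
- by rewrite prodfV exprVn cg.
exists (C + C') => [|k]; first exact: addr_gt0.
have gk := exprn_gt0 k g0; apply/andP; split.
  rewrite -[leRHS]invrK lef_pV2 ?posrE ?addr_gt0 ?invr_gt0 ?divr_gt0 ?P0//.
  have := PC' k; rewrite prodfV exprVn -/(P k) ler_pdivlMr// => PC'k.
  by rewrite invfM invrK (le_trans PC'k)// lerDr ltW.
by rewrite ler_pdivrMr// (le_trans (PC k))// ler_pM2r// lerDl ltW.
Qed.

(** * Bidiagonal systems and the annihilating functional *)

Definition bidiag_rel (R : realType) (a b x y : nat -> R[i]) : Prop :=
  y 0%N = a 0%N * x 0%N /\ forall k, y k.+1 = b k * x k + a k.+1 * x k.+1.

(** The sum telescopes: the recursion for [f] cancels both coefficients of each [x k] with [k < n],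
    leaving the boundary term. *)
Lemma bidiag_rel_pairing (R : realType) (a b f x y : nat -> R[i]) n :
  bidiag_rel a b x y -> (forall k, f k.+1 * b k = - (f k * a k)) ->
  \sum_(k < n.+1) f k * y k = f n * a n * x n.
Proof.
move=> [y0 yS] fS; elim: n => [|n IH]; first by rewrite big_ord1 y0 mulrA.
rewrite big_ord_recr/= IH yS mulrDr mulrA fS; ring.
Qed.

Lemma resolvent_set_lower_bound (R : realType) (T : {linear c0 R -> c0 R})
    (lam : R[i]) :
  resolvent_set T lam ->
  exists2 m : R, 0 <= m &
    forall x, c0_norm x <= m * c0_norm (shifted T lam x).
Proof.
(* The constant [M] is complex; only its real part enters a comparison of reals, and the absolute
   value makes it nonnegative. *)
move=> [_ [S SK [M MS]] _]; exists `|complex.Re M| => // x.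
have := MS _ (imageT (shifted T lam) x); rewrite SK.
rewrite -[`|x|]/(c0_norm x)%:C%C -[`|shifted _ _ _|]/(c0_norm _)%:C%C.
case: M {MS} => M M' /=; rewrite lecE => /andP[_] /=.
rewrite mulr0 subr0 => /le_trans; apply; rewrite ler_wpM2r ?ler_norm//.
exact: le_trans (normc_ge0 _) (le_c0_norm _ 0).
Qed.

Lemma bounded_dual_not_resolvent (R : realType) (T : {linear c0 R -> c0 R})
    (lam : R[i]) (a b f : nat -> R[i]) (K : R) :
  (forall x : c0 R, bidiag_rel a b x (shifted T lam x)) ->
  f 0%N = 1 -> (forall k, f k.+1 * b k = - (f k * a k)) ->
  (forall k, normc (f k * a k) <= K) -> ~ resolvent_set T lam.
Proof.
move=> Tab f0 fS fK lamT; have [m m0 mT] := resolvent_set_lower_bound lamT.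
have [_ _ dT] := lamT.
have K0 : 0 <= K := le_trans (normc_ge0 _) (fK 0%N).
have fT x n : normc (\sum_(k < n.+1) f k * shifted T lam x k) <= K * normc (x n).
  by rewrite (bidiag_rel_pairing _ (Tab x) fS) normcM ler_wpM2r ?normc_ge0.
(* Approximate the truncated phases of [f] within 1/2 by the image of some [x]. That image has norm
   at most 3/2, so [normc (x n) <= m * (3 / 2)], and the sum F satisfies F <= K * m * (3/2) +
   F/2. *)
have fsum n : \sum_(k < n.+1) normc (f k) <= 3 * K * m.
  have [u /all_and2[u1 fu]] := choice (fun k => exists_phase (f k)).
  have e0 : 0 < 1 / 2 :> R by lra.
  have [_ [x _ <-] xu] := dense_c0_approx (C0 (finite_c0P n.+1 u)) dT e0.
  have := normc_pairing_le n.+1 f xu.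
  have -> : \sum_(k < n.+1) f k * C0 (finite_c0P n.+1 u) k =
      (\sum_(k < n.+1) normc (f k))%:C%C.
    by rewrite rmorph_sum; apply: eq_bigr => k _ /=; rewrite ltn_ord fu.
  have F0 : 0 <= \sum_(k < n.+1) normc (f k).
    by apply: sumr_ge0 => k _; exact: normc_ge0.
  rewrite normc_real ger0_norm//.
  have Tx : c0_norm (shifted T lam x) <= 3 / 2.
    apply: c0_norm_le => k; set y := shifted T lam x k.
    pose v := if (k < n.+1)%N then u k else 0.
    have vy : normc (v - y) <= 1 / 2 := xu k.
    have v1 : normc v <= 1 by rewrite /v; case: ifP; rewrite ?normc0 ?ler01 ?u1.
    rewrite (_ : y = v - (v - y)); last by rewrite subKr.
    rewrite (le_trans (le_normcD _ _))// normcN; lra.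
  have xn : K * normc (x n) <= K * (m * (3 / 2)).
    rewrite ler_wpM2l// (le_trans (le_c0_norm _ _))// (le_trans (mT x))//.
    by rewrite ler_wpM2l.
  have := fT x n; lra.
(* Since [D] bounds the sums for every [n], the unit sequence at index 0 can be approximated by one
   image with a tolerance independent of [n]. Taking [n] afterwards with [x n] small yields 1 <= 1/2
   + 1/4. *)
pose D := 3 * K * m; have D0 : 0 <= D by rewrite !mulr_ge0.
have e0 : 0 < 1 / (4 * (D + 1)) by rewrite divr_gt0//; lra.
have [_ [x _ <-] xe] := dense_c0_approx (C0 (finite_c0P 1 (fun=> 1 : R[i]))) dT e0.
have t0 : 0 < 1 / (2 * (K + 1)) by rewrite divr_gt0//; lra.
have [n /(_ n (leqnn n)) xn] := (c0_predP x).1 (c0_seqP x) _ t0.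
have le1 := normc_pairing_le n.+1 f xe.
rewrite (_ : \sum_(k < n.+1) _ = 1) ?normc1 in le1; last first.
  by rewrite big_ord_recl/= f0 mulr1 big1 ?addr0// => k _; rewrite mulr0.
have Kx : K * normc (x n) <= 1 / 2.
  rewrite (le_trans (ler_wpM2l K0 (ltW xn)))//.
  by rewrite mulrA ler_pdivrMr; lra.
have ef : 1 / (4 * (D + 1)) * \sum_(k < n.+1) normc (f k) <= 1 / 4.
  rewrite (le_trans (ler_wpM2l (ltW e0) (fsum n)))//.
  by rewrite -/D mulrAC ler_pdivrMr; lra.
have := le_trans le1 (lerD (le_trans (fT x n) Kx) ef).
by lra.
Qed.

(** * Forward substitution and the bounded inverse *)

(** Forward substitution for the unknowns [a k * x k] rather than [x k]; the solution is recovered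
    on division by [a k]. *)
Fixpoint bidiag_solve (R : realType) (a b y : nat -> R[i]) (k : nat) : R[i] :=
  if k is k'.+1 then y k - b k' / a k' * bidiag_solve a b y k' else y 0%N.

(** The relation on [w] turns the factor |b_k / a_k| into exactly [rho] for the weighted moduli, and
    the source term is at most [t / m]. Starting at [N = 0] gives the norm bound; a late start gives
    convergence to 0. *)
Lemma bidiag_solve_estimate (R : realType) (a b y : nat -> R[i])
    (w : nat -> R) (m rho t : R) N :
  0 <= rho -> rho < 1 -> 0 < m -> (forall k, m <= w k) ->
  (forall k, w k.+1 * rho = w k * (normc (b k) / normc (a k))) ->
  0 <= t -> (forall k, (N < k)%N -> normc (y k) <= t) ->
  forall k, normc (bidiag_solve a b y (N + k)) / w (N + k)%N <=
    rho ^+ k * (normc (bidiag_solve a b y N) / w N) + t / m / (1 - rho).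
Proof.
move=> r0 r1 m0 mw wS t0 yt; set z := bidiag_solve a b y.
have w0 k : 0 < w k := lt_le_trans m0 (mw k).
apply: (affine_recursion_le (v := fun k => normc (z k) / w k)) => //.
  by rewrite divr_ge0// ltW.
move=> k Nk; rewrite ler_pdivrMr// mulrDl.
have -> : rho * (normc (z k) / w k) * w k.+1 =
    normc (b k) / normc (a k) * normc (z k).
  transitivity (normc (z k) / w k * (w k.+1 * rho)); first by ring.
  by rewrite wS mulrA divfK ?gt_eqF// mulrC.
rewrite [z k.+1]/(y k.+1 - b k / a k * z k).
rewrite [leRHS]addrC (le_trans (le_normcD _ _))// lerD//.
  rewrite (le_trans (yt _ _))// -mulrA ler_peMr// mulrC ler_pdivlMr// mul1r.
  exact: mw.
by rewrite normcN !normcM normcV.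
Qed.

Lemma bidiag_solve_c0 (R : realType) (a b y : nat -> R[i])
    (w : nat -> R) (m M L rho : R) :
  0 <= rho -> rho < 1 -> 0 < m -> (forall k, m <= w k) ->
  (forall k, w k <= M) -> (forall k, (normc (a k))^-1 <= L) ->
  (forall k, w k.+1 * rho = w k * (normc (b k) / normc (a k))) ->
  y \in @c0_pred R -> (fun k => bidiag_solve a b y k / a k) \in @c0_pred R.
Proof.
move=> r0 r1 m0 mw wM aL wS /c0_predP yc; apply/c0_predP => e e0.
have w0 k : 0 < w k := lt_le_trans m0 (mw k).
have r1' : 0 < 1 - rho by rewrite subr_gt0.
have M0 : 0 < M := lt_le_trans (w0 0%N) (wM 0%N).
have L0 : 0 <= L by rewrite (le_trans _ (aL 0%N))// invr_ge0 normc_ge0.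
(* Passing from the weighted modulus back to the solution costs a factor [M * L]; the 1 makes the
   final inequality strict. *)
pose e' := e / (M * (L + 1)).
have L1 : 0 < L + 1 by rewrite ltr_wpDl.
have ML : 0 < M * (L + 1) by rewrite mulr_gt0.
have e'0 : 0 < e' by rewrite divr_gt0.
(* Chosen so that the stationary term [t / m / (1 - rho)] equals [e' / 2]; the geometric term takes
   the other half. *)
pose t := e' / 2 * (1 - rho) * m.
have t0 : 0 < t by rewrite /t !mulr_gt0 ?invr_gt0.
have [N yN] := yc _ t0.
have yt k : (N < k)%N -> normc (y k) <= t by move=> /ltnW/yN/ltW.
have est := bidiag_solve_estimate r0 r1 m0 mw wS (ltW t0) yt.
set z := bidiag_solve a b y in est *; set v := normc (z N) / w N in est.
have v0 : 0 <= v by rewrite divr_ge0 ?normc_ge0// ltW.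
have : (rho ^+ k) @[k --> \oo] --> (0 : R) by apply: cvg_expr; rewrite ger0_norm.
have e2 : 0 < e' / 2 / (v + 1) by rewrite !divr_gt0// ltr_wpDl.
move=> /cvgrPdist_lt/(_ _ e2)[N' _ rN'].
exists (N + N')%N => k Nk; rewrite normcM normcV.
have -> : k = (N + (k - N))%N by rewrite subnKC// (leq_trans _ Nk)// leq_addr.
set k' := (k - N)%N; have : (N' <= k')%N by rewrite leq_subRL// (leq_trans _ Nk)// leq_addr.
move=> /rN'; rewrite /= sub0r normrN ger0_norm ?exprn_ge0// => rk.
have zk : normc (z (N + k')%N) / w (N + k')%N < e'.
  rewrite (le_lt_trans (est _))// [ltRHS]splitr ltr_leD//; last first.
    by rewrite /t mulfK ?gt_eqF// mulfK ?gt_eqF.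
  rewrite (le_lt_trans (y := rho ^+ k' * (v + 1)))//.
    by rewrite ler_wpM2l ?exprn_ge0// lerDl.
  by rewrite -ltr_pdivlMr// ltr_wpDl.
rewrite (@le_lt_trans _ _ (e' * M * L))//.
  rewrite ler_pM ?invr_ge0 ?normc_ge0//.
  have := ltW zk; rewrite ler_pdivrMr// => /le_trans; apply.
  by rewrite ler_wpM2l// ltW.
rewrite /e' -mulrA mulrAC ltr_pdivrMr// ltr_pM2l// ltr_pM2l//.
by rewrite ltrDl.
Qed.

Lemma bidiag_solveK (R : realType) (a b x y : nat -> R[i]) :
  bidiag_rel a b x y -> (forall k, a k != 0) ->
  forall k, bidiag_solve a b y k / a k = x k.
Proof.
move=> [y0 yS] a0 k; apply: (canLR (mulfK (a0 k))).
elim: k => [|k IH] /=; first by rewrite y0 mulrC.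
by rewrite IH yS; field.
Qed.

Lemma bidiag_rel_solve (R : realType) (a b y : nat -> R[i]) :
  (forall k, a k != 0) ->
  bidiag_rel a b (fun k => bidiag_solve a b y k / a k) y.
Proof.
by move=> a0; split=> [|k] /=; field; rewrite ?a0.
Qed.

Lemma bidiag_rel_fun (R : realType) (a b x y y' : nat -> R[i]) :
  bidiag_rel a b x y -> bidiag_rel a b x y' -> y = y'.
Proof.
move=> [y0 yS] [y'0 y'S]; apply/funext => -[|k]; first by rewrite y0 y'0.
by rewrite yS y'S.
Qed.

(** Forward substitution maps [c0] to itself and is a two-sided inverse, so the range is everything
    and density is immediate. *)
Lemma bidiag_rel_resolvent (R : realType) (T : {linear c0 R -> c0 R})
    (lam : R[i]) (a b : nat -> R[i]) (w : nat -> R) (m M L rho : R) :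
  (forall x : c0 R, bidiag_rel a b x (shifted T lam x)) ->
  (forall k, a k != 0) ->
  0 <= rho -> rho < 1 -> 0 < m -> (forall k, m <= w k) ->
  (forall k, w k <= M) -> (forall k, (normc (a k))^-1 <= L) ->
  (forall k, w k.+1 * rho = w k * (normc (b k) / normc (a k))) ->
  resolvent_set T lam.
Proof.
move=> Tab a0 r0 r1 m0 mw wM aL wS.
have w0 k : 0 < w k := lt_le_trans m0 (mw k).
have r1' : 0 < 1 - rho by rewrite subr_gt0.
have M0 : 0 < M := lt_le_trans (w0 0%N) (wM 0%N).
have L0 : 0 <= L by rewrite (le_trans _ (aL 0%N))// invr_ge0 normc_ge0.
pose S (y : c0 R) : c0 R := C0 (bidiag_solve_c0 r0 r1 m0 mw wM aL wS (c0_seqP y)).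
have SE y k : S y k = bidiag_solve a b y k / a k by [].
have SK : cancel (shifted T lam) S.
  move=> x; apply: val_inj; apply/funext => k.
  exact: bidiag_solveK (Tab x) a0 k.
have KS y : shifted T lam (S y) = y.
  apply: val_inj; apply: bidiag_rel_fun (Tab (S y)) _.
  exact: bidiag_rel_solve.
split; first exact: can_inj SK.
  (* [1 / m] accounts for the initial value [y 0], the next term for the source, and [M * L] for
     removing the weight and dividing by [a k]. *)
  exists S => //; exists (M * L * (1 / m + 1 / m / (1 - rho)))%:C%C => y _.
  rewrite -[`|S y|]/(c0_norm (S y))%:C%C -[`|y|]/(c0_norm y)%:C%C -rmorphM lecR.
  apply: c0_norm_le => k; rewrite SE normcM normcV.
  have Y0 : 0 <= c0_norm y := le_trans (normc_ge0 _) (le_c0_norm _ 0).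
  have := bidiag_solve_estimate (N := 0) r0 r1 m0 mw wS Y0 (fun k _ => le_c0_norm y k) k.
  rewrite add0n; set z := bidiag_solve a b y; set Y := c0_norm y => est.
  have y0 : normc (z 0%N) / w 0%N <= Y / m.
    by rewrite ler_pM ?normc_ge0 ?invr_ge0 ?lef_pV2 ?posrE ?le_c0_norm// ltW.
  have zk : normc (z k) / w k <= Y / m + Y / m / (1 - rho).
    apply: le_trans est _; rewrite lerD2r (le_trans _ y0)// ler_piMl//.
      by rewrite divr_ge0 ?normc_ge0// ltW.
    by rewrite exprn_ile1// ltW.
  rewrite (@le_trans _ _ ((Y / m + Y / m / (1 - rho)) * M * L))//; last first.
    by rewrite le_eqVlt; apply/orP; left; apply/eqP; ring.
  rewrite ler_pM ?invr_ge0 ?normc_ge0//.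
  move: zk; rewrite ler_pdivrMr// => /le_trans; apply.
  rewrite ler_wpM2l// -mulrA addr_ge0// !mulr_ge0// ?invr_ge0 ltW//.
move=> O [y Oy] _; exists y; split => //; exists (S y) => //; exact: KS.
Qed.

(** * Geometric means and the periodic operator *)

Lemma normc_prod (R : realType) n (f : nat -> R[i]) :
  normc (\prod_(k < n) f k) = \prod_(k < n) normc (f k).
Proof.
elim: n => [|n IH]; first by rewrite !big_ord0 normc1.
by rewrite !big_ord_recr normcM IH.
Qed.

Lemma powR_rootK (R : realType) (x : R) n :
  (0 < n)%N -> 0 <= x -> (x `^ n%:R^-1) ^+ n = x.
Proof.
move=> n0 x0; rewrite -powR_mulrn ?powR_ge0// -powRrM mulVf ?powRr1//.
by rewrite pnatr_eq0 -lt0n.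
Qed.

Lemma bidiag_op_rel (R : realType) (l l' : nat) (hl : (0 < l)%N)
    (hl' : (0 < l')%N) (r : 'I_l -> R[i]) (s : 'I_l' -> R[i]) (lam : R[i])
    (x : c0 R) :
  bidiag_rel (fun k => r (Ordinal (ltn_pmod k hl)) - lam)
    (fun k => s (Ordinal (ltn_pmod k hl'))) x
    (shifted (bidiag_op hl hl' r s) lam x).
Proof.
split=> [|k].
  rewrite -[LHS]/(ltri_act (bidiag hl hl' r s) x 0 - lam * x 0%N).
  by rewrite bidiag_act0 mulrBl.
rewrite -[LHS]/(ltri_act (bidiag hl hl' r s) x k.+1 - lam * x k.+1).
by rewrite bidiag_actS mulrBl addrA.
Qed.

Theorem theorem3p3 (R : realType) (l l' : nat) (hl : (0 < l)%N)
    (hl' : (0 < l')%N) (r : 'I_l -> R[i]) (s : 'I_l' -> R[i])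
    (hs : forall i, s i != 0) :
  spectrum (bidiag_op hl hl' r s) =
  [set lam : R[i] | (\prod_(i < l) normc (lam - r i)) `^ (l%:R^-1)
                    <= (\prod_(i < l') normc (s i)) `^ (l'%:R^-1)].
Proof.
apply/predeqP => lam /=; have Tab := bidiag_op_rel hl hl' r s lam.
have -> : \prod_(i < l) normc (lam - r i) = \prod_(i < l) normc (r i - lam).
  by apply: eq_bigr => i _; rewrite -normcN opprB.
have normc_gt0 (z : R[i]) : z != 0 -> 0 < normc z.
  by move=> z0; rewrite lt_def normc_ge0 andbT; apply: contra_neq z0 => /eq0_normc.
set alpha := (\prod_(i < l) _) `^ _; set beta := _ `^ _.
have alphaE : \prod_(i < l) normc (r i - lam) = alpha ^+ l.
  by rewrite powR_rootK// prodr_ge0// => i _; exact: normc_ge0.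
have s0 i : 0 < normc (s i) by exact: normc_gt0.
have beta0 : 0 < beta by rewrite powR_gt0// prodr_gt0.
have [|Cb Cb0 bC] := prod_periodic_bounds hl' beta0 s0.
  by rewrite powR_rootK// ltW// prodr_gt0.
move: Tab bC; set a := fun k => r (Ordinal (ltn_pmod k hl)) - lam.
set b := fun k => s (Ordinal (ltn_pmod k hl')) => Tab bC.
have b0 k : b k != 0 by exact: hs.
split=> [|ab].
  (* Here [beta < alpha], so [alpha] is positive and [lam] differs from every [r i]. *)
  apply: contra_notT; rewrite -ltNge => ba.
  have alpha0 : 0 < alpha by exact: lt_trans ba.
  have r0 i : r i - lam != 0.
    have : alpha ^+ l != 0 by rewrite expf_neq0// gt_eqF.
    rewrite -alphaE => /prodf_neq0/(_ i isT); apply: contra_neq => ->.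
    exact: normc0.
  have a0 k : a k != 0 by exact: r0.
  have [Ca Ca0 aC] := prod_periodic_bounds hl alpha0 (fun i => normc_gt0 _ (r0 i)) alphaE.
  rewrite -/a in aC.
  pose pa k := (\prod_(j < k) normc (a j)) / alpha ^+ k.
  pose pb k := (\prod_(j < k) normc (b j)) / beta ^+ k.
  have pa0 k : 0 < pa k.
    by have /andP[+ _] := aC k; apply: lt_le_trans; rewrite invr_gt0.
  have pb0 k : 0 < pb k.
    by have /andP[+ _] := bC k; apply: lt_le_trans; rewrite invr_gt0.
  (* Successive weights have ratio (|b_k| / |a_k|) * (alpha / beta), which is what
     [rho = beta / alpha] requires; periodicity bounds them on both sides. *)
  apply: (bidiag_rel_resolvent (w := fun k => pb k / pa k) (m := Cb^-1 / Ca)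
    (M := Cb * Ca) (L := \sum_(i < l) normc ((r i - lam)^-1))
    (rho := beta / alpha) Tab a0).
  - by rewrite ltW// divr_gt0.
  - by rewrite ltr_pdivrMr// mul1r.
  - by rewrite divr_gt0// invr_gt0.
  - move=> k; have /andP[_ pak] := aC k; have /andP[pbk _] := bC k.
    by rewrite ler_pM ?invr_ge0 ?lef_pV2 ?posrE ?pa0// ltW.
  - move=> k; have /andP[pak _] := aC k; have /andP[_ pbk] := bC k.
    rewrite ler_pM ?invr_ge0 ?(ltW (pa0 _)) ?(ltW (pb0 _))//.
    by rewrite -[Ca]invrK lef_pV2 ?posrE ?pa0 ?invr_gt0.
  - by move=> k; rewrite -normcV; exact: le_sum_normc (fun i => (r i - lam)^-1) _.
  - move=> k; rewrite /pa /pb !big_ord_recr/= !exprSr.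
    have na : \prod_(j < k) normc (a j) != 0.
      by rewrite gt_eqF// prodr_gt0// => j _; exact: normc_gt0.
    by field; rewrite na !expf_neq0 ?gt_eqF// normc_gt0.
(* Now [alpha] may vanish, so the products of |a_j| are compared from above with powers of [beta],
   using [alpha <= beta]. *)
have [|C C0 aC] := prod_periodic_le hl beta0 (fun i => normc_ge0 (r i - lam)).
  by rewrite alphaE lerXn2r ?nnegrE ?powR_ge0.
(* In [K], the factor [C * Cb] bounds |f_k|, the powers of [beta] cancelling, and the sum bounds
   |a_k|. *)
apply: (bounded_dual_not_resolvent (f := fun k => \prod_(j < k) (- a j / b j))
  (K := C * Cb * \sum_(i < l) normc (r i - lam)) Tab).
- by rewrite big_ord0.
- by move=> k; rewrite big_ord_recr/= mulrA divfK// mulrN.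
- move=> k; rewrite normcM ler_pM ?normc_ge0//; last first.
    exact: le_sum_normc (fun i => r i - lam) _.
  rewrite (normc_prod _ (fun j => - a j / b j)).
  rewrite (eq_bigr (fun j : 'I_k => normc (a j) / normc (b j))); last first.
    by move=> j _; rewrite normcM normcN normcV.
  rewrite prodf_div ler_pdivrMr; last by apply: prodr_gt0 => j _; exact: s0.
  apply: le_trans (aC k) _; rewrite -mulrA ler_pM2l//.
  have /andP[+ _] := bC k; rewrite ler_pdivlMr ?exprn_gt0//.
  by rewrite ler_pdivrMl.
Qed.
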